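(* Let $\Omega$ be a finite set, and let $a,b,c\subseteq\Omega\times\Omega$ be relations. If $b$ is regular, then \[ \|ac\|\cdot\|b\|\leq\|ab\|\cdot\|b^*c\|. \]
   Context: For relations $a,b\subseteq\Omega\times\Omega$: the product is $ab=\{(\alpha,\beta)\in\Omega\times\Omega\mid(\alpha,\gamma)\in a,\ (\gamma,\beta)\in b\text{ for some }\gamma\in\Omega\}$; the transpose is $a^*=\{(\beta,\alpha)\mid(\alpha,\beta)\in a\}$; for $\omega\in\Omega$, $\omega a=\{\beta\in\Omega\mid(\omega,\beta)\in a\}$; and $\|a\|=\max_{\omega\in\Omega}|\omega a|$ is the maximum outdegree (taken to be $0$ if $\Omega$ is empty). The relation $a$ is regular if $|\omega a|$ does not depend on the choice of $\omega\in\Omega$ (only outdegrees are required to be constant). *)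

(* Defs.v *)
From mathcomp Require Import all_boot.

Set Implicit Arguments.
Unset Strict Implicit.
Unset Printing Implicit Defensive.

Definition relprod (T : finType) (a b : {set T * T}) : {set T * T} :=
  [set p | [exists g, ((p.1, g) \in a) && ((g, p.2) \in b)]].

Definition reltr (T : finType) (a : {set T * T}) : {set T * T} :=
  [set p | (p.2, p.1) \in a].

Definition outnbr (T : finType) (w : T) (a : {set T * T}) : {set T} :=
  [set x | (w, x) \in a].

(* The empty maximum is 0, so [maxoutdeg a = 0] when [T] is empty. *)
Definition maxoutdeg (T : finType) (a : {set T * T}) : nat :=
  \max_(w : T) #|outnbr w a|.

(* Only outdegrees are constrained; indegrees may vary. *)
Definition regular_rel (T : finType) (a : {set T * T}) : Prop :=
  forall w1 w2 : T, #|outnbr w1 a| = #|outnbr w2 a|.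

(* Main.v *)
(* Ruzsa's triangle inequality: fix [w] and double count the pairs [(d, x)]
   with [d] in [w(ab)], [x] in [w(ac)] and [x] in [d(b^*c)]. For each [x] in [w(ac)],
   through some [g], all of [gb] consists of admissible [d]. *)
Require Import Defs.
From mathcomp Require Import all_boot.

Lemma mem_outnbr_relprod (T : finType) (a b : {set T * T}) (w x : T) :
  reflect (exists2 g, (w, g) \in a & (g, x) \in b)
          (x \in outnbr w (relprod a b)).
Proof.
rewrite !inE; apply: (iffP existsP) => /= [[g /andP[]]|[g wg gx]]; exists g => //.
by rewrite wg gx.
Qed.

Lemma leq_outnbr_maxoutdeg (T : finType) (a : {set T * T}) (w : T) :
  #|outnbr w a| <= maxoutdeg a.
Proof. exact: (leq_bigmax w). Qed.

Lemma regular_maxoutdeg (T : finType) (b : {set T * T}) (w : T) :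
  regular_rel b -> maxoutdeg b <= #|outnbr w b|.
Proof. by move=> hb; apply/bigmax_leqP => v _; rewrite (hb v w). Qed.

Lemma outnbr_ruzsa (T : finType) (a b c : {set T * T}) (w : T) :
  regular_rel b ->
  #|outnbr w (relprod a c)| * maxoutdeg b
    <= #|outnbr w (relprod a b)| * maxoutdeg (relprod (reltr b) c).
Proof.
move=> hb; rewrite -!sum_nat_const.
pose N d := outnbr d (relprod (reltr b) c).
apply: (@leq_trans (\sum_(x in outnbr w (relprod a c))
                     \sum_(d in outnbr w (relprod a b) | x \in N d) 1)).
  apply: leq_sum => x /mem_outnbr_relprod[g wg gx].
  (* The vertex [g] varies with [x], so regularity is what lets every such [g] attain [maxoutdeg b].
     A [d] in [outnbr g b] is reached from [w] via [g], and reaches [x] via [g] by reversing the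
     [b]-step. *)
  apply: leq_trans (regular_maxoutdeg _ b g hb) _.
  rewrite sum1dep_card; apply/subset_leq_card/subsetP => d; rewrite !in_set => gd.
  by apply/andP; split; apply/existsP; exists g; rewrite ?in_set /= ?wg ?gd ?gx.
(* Counted by [d] instead, each fibre lies inside [N d]. *)
rewrite (exchange_big_dep [in outnbr w (relprod a b)]) /= => [|x d _ /andP[]//].
apply: leq_sum => d dab; apply: leq_trans (leq_outnbr_maxoutdeg _ _ d).
rewrite sum1dep_card; apply/subset_leq_card/subsetP => x.
by rewrite inE => /and3P[].
Qed.

Theorem theorem3p1 (T : finType) (a b c : {set T * T})
  (hb : regular_rel b) :
  maxoutdeg (relprod a c) * maxoutdeg b
    <= maxoutdeg (relprod a b) * maxoutdeg (relprod (reltr b) c).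
Proof.
(* As a property of the first factor, the bound holds at 0, which covers empty [T], and is preserved
   by [maxn]; this leaves a single [w]. *)
rewrite {1}/maxoutdeg; elim/big_ind: _ => // [m n|w _].
  by rewrite maxnMl geq_max => -> ->.
apply: leq_trans (outnbr_ruzsa _ a b c w hb) _.
by rewrite leq_mul2r leq_outnbr_maxoutdeg orbT.
Qed.
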